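(* Let $k\ge 2$ be an integer, let $\mathcal{T}$ be a tree of homogeneity $k$ on the non-atomic probability space $(X,\mu)$, and let $w$ be an $A_1$ weight with respect to $\mathcal{T}$ with $A_1$ constant $[w]^{\mathcal{T}}_1=c$. Let $w^\ast:(0,1]\to\mathbb{R}^+$ be defined by $w^\ast(t)=\sup_{e\subseteq X,\ \mu(e)\ge t}\ \inf_{x\in e}w(x)$, $t\in(0,1]$ (the supremum being over measurable sets $e$). Then $$\frac{1}{t}\int_0^t w^\ast(y)\,dy\le (kc-k+1)\,w^\ast(t)\qquad\text{for every } t\in(0,1].$$ Moreover, the constant on the right-hand side is sharp if one considers all $A_1$ weights with respect to $\mathcal{T}$ with constant $[w]^{\mathcal{T}}_1=c$: for every $c\ge 1$, the constant $kc-k+1$ cannot be replaced by any smaller constant for which the inequality holds for all $A_1$ weights $w$ with respect to $\mathcal{T}$ with $[w]^{\mathcal{T}}_1=c$ and all $t\in(0,1]$.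
   Context: Let $(X,\mu)$ be a non-atomic probability space and $k\ge 2$ an integer. A set $\mathcal{T}$ of measurable subsets of $X$ is called a tree of homogeneity $k$ if: (i) For every $I\in\mathcal{T}$ there corresponds a subset $C(I)\subseteq\mathcal{T}$ containing exactly $k$ pairwise disjoint subsets of $I$ such that $I=\bigcup C(I)$ and each element of $C(I)$ has measure $(1/k)\mu(I)$. (ii) $\mathcal{T}=\bigcup_{m\ge 0}\mathcal{T}_{(m)}$, where $\mathcal{T}_{(0)}=\{X\}$ and $\mathcal{T}_{(m+1)}=\bigcup_{I\in\mathcal{T}_{(m)}}C(I)$. (iii) $\mathcal{T}$ differentiates $L^1(X,\mu)$: if $\varphi\in L^1(X,\mu)$, then for $\mu$-almost all $x\in X$ and every sequence $(I_j)_{j\in\mathbb{N}}$ with $x\in I_j$, $I_j\in\mathcal{T}$ and $\mu(I_j)\to 0$, we have $\varphi(x)=\lim_{j\to\infty}\frac{1}{\mu(I_j)}\int_{I_j}\varphi\,d\mu$. The associated maximal operator is $\mathcal{M}_{\mathcal{T}}\varphi(x)=\sup\{\frac{1}{\mu(I)}\int_I|\varphi|\,d\mu : x\in I\in\mathcal{T}\}$ for $\varphi\in L^1(X,\mu)$. A non-negative integrable function $w$ on $X$ is an $A_1$ weight with respect to $\mathcal{T}$ if there is a constant $C$ with $\mathcal{M}_{\mathcal{T}}w(x)\le C\,w(x)$ for almost every $x\in X$; the smallest such constant $C$ is the $A_1$ constant of $w$ with respect to $\mathcal{T}$, denoted $[w]^{\mathcal{T}}_1$. *)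

(* Defs.v *)
From HB Require Import structures.
From mathcomp Require Import all_boot all_order all_algebra.
From mathcomp Require Import all_classical all_reals all_analysis.
Set Implicit Arguments.
Unset Strict Implicit.
Unset Printing Implicit Defensive.
Import Order.TTheory GRing.Theory Num.Theory.
Import numFieldNormedType.Exports.
Local Open Scope classical_set_scope.
Local Open Scope ring_scope.

Definition non_atomic (R : realType) (d : measure_display)
    (X : measurableType d) (mu : probability X R) : Prop :=
  forall A : set X, measurable A -> (0 < mu A)%E ->
    exists B : set X,
      [/\ measurable B, B `<=` A, (0 < mu B)%E & (mu B < mu A)%E].

Definition average (R : realType) (d : measure_display)
    (X : measurableType d) (mu : probability X R) (f : X -> R) (I : set X)
    : \bar R :=
  ((fine (mu I))^-1%:E * \int[mu]_(x in I) (f x)%:E)%E.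

Fixpoint tree_level (X : Type) (C : set X -> set (set X)) (m : nat)
    : set (set X) :=
  if m is n.+1 then \bigcup_(I in tree_level C n) C I else [set setT].

Definition differentiates_L1 (R : realType) (d : measure_display)
    (X : measurableType d) (mu : probability X R) (T : set (set X)) : Prop :=
  forall phi : X -> R, mu.-integrable setT (EFin \o phi) ->
    {ae mu, forall x, forall I : nat -> set X,
      (forall j, T (I j) /\ I j x) ->
      mu (I j) @[j --> \oo] --> 0%E ->
      average mu phi (I j) @[j --> \oo] --> (phi x)%:E}.

Definition homogeneous_tree (R : realType) (d : measure_display)
    (X : measurableType d) (mu : probability X R) (k : nat)
    (T : set (set X)) : Prop :=
  [/\ forall I, T I -> measurable I,
      exists C : set X -> set (set X),
        (forall I, T I ->
          [/\ C I `<=` T,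
              (C I #= `I_k)%card,
              (forall J J', C I J -> C I J' -> J <> J' -> J `&` J' = set0),
              I = \bigcup_(J in C I) J &
              forall J, C I J -> mu J = ((k%:R^-1)%:E * mu I)%E]) /\
        T = \bigcup_m tree_level C m &
      differentiates_L1 mu T].

Definition tree_maximal (R : realType) (d : measure_display)
    (X : measurableType d) (mu : probability X R) (T : set (set X))
    (phi : X -> R) (x : X) : \bar R :=
  ereal_sup [set average mu (fun y => `|phi y|) I | I in [set I | T I /\ I x]].

(* [0 <= C] only matters when w = 0 almost everywhere: otherwise the inequality
   forces 1 <= C, whereas for w = 0 it holds for every real C. *)
Definition A1_bound (R : realType) (d : measure_display)
    (X : measurableType d) (mu : probability X R) (T : set (set X))
    (w : X -> R) (C : R) : Prop :=
  0 <= C /\ {ae mu, forall x, (tree_maximal mu T w x <= (C * w x)%:E)%E}.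

Definition A1_weight (R : realType) (d : measure_display)
    (X : measurableType d) (mu : probability X R) (T : set (set X))
    (w : X -> R) : Prop :=
  [/\ forall x, 0 <= w x,
      mu.-integrable setT (EFin \o w) &
      exists C, A1_bound mu T w C].

Definition A1_constant (R : realType) (d : measure_display)
    (X : measurableType d) (mu : probability X R) (T : set (set X))
    (w : X -> R) (c : R) : Prop :=
  A1_bound mu T w c /\ forall C, A1_bound mu T w C -> c <= C.

(* For w nonnegative and integrable and t in (0, 1], both extrema are over
   nonempty sets bounded on the relevant side (each infimum is at most
   t^-1 * \int w), so the real-valued [sup] and [inf] are the true ones. *)
Definition decreasing_rearrangement (R : realType) (d : measure_display)
    (X : measurableType d) (mu : probability X R) (w : X -> R) (t : R) : R :=
  sup [set inf (w @` e) | e in [set e | measurable e /\ (t%:E <= mu e)%E]].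

Definition rearrangement_bound (R : realType) (d : measure_display)
    (X : measurableType d) (mu : probability X R) (w : X -> R) (K : R)
    : Prop :=
  forall t : R, 0 < t <= 1 ->
    ((t^-1)%:E * \int[lebesgue_measure]_(y in `]0%R, t]%classic)
                    (decreasing_rearrangement mu w y)%:E
     <= (K * decreasing_rearrangement mu w t)%:E)%E.

(* Main.v *)
Require Import Defs.
From HB Require Import structures.
From mathcomp Require Import all_boot all_order all_algebra.
From mathcomp Require Import all_classical all_reals all_analysis.
From mathcomp Require Import measurable_realfun ring lra.
Set Implicit Arguments.
Unset Strict Implicit.
Unset Printing Implicit Defensive.
Import Order.TTheory GRing.Theory Num.Theory.
Local Open Scope classical_set_scope.
Local Open Scope ring_scope.

(** Write [w*] for the decreasing rearrangement of [w], [a = w*(t)],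
    [K = k c - k + 1], and [avg I] for the mean of [w] over a cell [I] of the
    tree.

    Upper bound. Two facts about [w*] reduce the claim to an inequality on [X]:
    since [w*] and [w] have the same tails, the integral of [w* - a] over
    [(0, t]] is at most the integral of [(w - a)^+] over [X]
    ([integral_rearrangement_le], by the layer-cake formula), and the set
    [{w > a}] has measure at most [t] ([measure_gt_rearrangement]).  So it is
    enough that the integral of [(w - a)^+] be at most
    [(K - 1) a mu{w > a}] ([excess_integral_le]).

    For this, stop at the first cells, going down the tree, whose mean exceeds
    [c a], and let [E] be their union.  The A1 condition gives [w > a] almost
    everywhere on [E], and the differentiation property gives [w <= c a <= K a]
    almost everywhere off [E].  On [E] the point is that the mean over a
    stopping cell [J] is at most [K a] ([child_integral_le]): its parent [I]
    has mean at most [c a], and by the A1 condition each of the [k - 1]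
    siblings of [J] has mean at least [avg I / c], so
    [avg J <= k avg I - (k - 1) avg I / c = (K / c) avg I <= K a].
    Using only [avg J <= k avg I] would lose the sharp constant.

    Sharpness. The chain above is an equality when the parent is [X] and [w] is
    constant on each child: let [w = K] on one child [J] of [X] and [w = 1]
    elsewhere.  The mean over [X] is then [c], which is the A1 constant.  For
    [t] slightly above [1/k] we have [w*(t) = 1], while the mean of [w*] over
    [(0, t]] is at least [K / (k t)], which tends to [K]. *)

(** * Layer-cake formula *)

(** Tonelli applied to the region under the graph of [f]. *)
Lemma layer_cake (R : realType) (d : measure_display) (Y : measurableType d)
    (m : {sigma_finite_measure set Y -> \bar R}) (f : Y -> R) :
  measurable_fun setT f -> (forall x, 0 <= f x) ->
  (\int[m]_x (f x)%:E =
   \int[lebesgue_measure]_(s in `[0%R, +oo[) m [set x | (s < f x)%R])%E.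
Proof.
move=> mf f0.
pose A : set (Y * measurableTypeR R) := [set p | 0 <= p.2 /\ p.2 < f p.1].
have mA : measurable A.
  have -> : A = (fun p : Y * measurableTypeR R => (0 <= p.2)%R) @^-1` [set true]
     `&` (fun p : Y * measurableTypeR R => (p.2 < f p.1)%R) @^-1` [set true].
    by apply/seteqP; split.
  apply: measurableI; rewrite -[X in measurable X]setTI.
    exact: (measurable_fun_ler (measurable_cst _) measurable_snd).
  apply: (measurable_fun_ltr measurable_snd) => //.
  exact: (measurableT_comp mf measurable_fst).
have := indic_fubini_tonelli m (@lebesgue_measure R) mA.
rewrite indic_fubini_tonelli_FE// indic_fubini_tonelli_GE//.
under eq_integral => x _.
  rewrite /= (_ : xsection A x = `[0%R, f x[%classic); last first.
    by apply/seteqP; split => s; rewrite xsectionE /A /= in_itv/= => /andP.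
  rewrite lebesgue_measure_itv/= lte_fin.
  rewrite (_ : (if _ then _ else _) = (f x)%:E); last first.
    by have := f0 x; rewrite le_eqVlt => /predU1P[<-|->]; rewrite ?ltxx ?sube0.
  over.
move=> ->; rewrite [RHS]integral_mkcond; apply: eq_integral => s _.
rewrite /= patchE; case: ifPn => [|/negP]; rewrite in_setE/= in_itv/= andbT.
  move=> s0; congr (m _); apply/seteqP; split => x; rewrite ysectionE /A /=.
    by case.
  by [].
move=> s0; rewrite (_ : ysection _ _ = set0) ?measure0//.
by apply/seteqP; split => x; rewrite ysectionE /A //= => -[].
Qed.

(** The tail function is the measure of the horizontal sections of the
    subgraph of [f]. *)
Lemma measurable_tail (R : realType) (d : measure_display)
    (Y : measurableType d) (m : {sigma_finite_measure set Y -> \bar R})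
    (f : Y -> R) : measurable_fun setT f ->
  measurable_fun setT (fun s : measurableTypeR R => m [set x | s < f x]).
Proof.
move=> mf; pose A : set (Y * measurableTypeR R) := [set p | p.2 < f p.1].
have mA : measurable A.
  rewrite -[X in measurable X]setTI.
  apply: (measurable_fun_ltr measurable_snd _ measurableT (Y := [set true])) => //.
  exact: (measurableT_comp mf measurable_fst).
apply: (eq_measurable_fun (m \o ysection A)); last exact: measurable_fun_ysection.
by move=> s _ /=; congr (m _); apply/seteqP; split => x; rewrite ysectionE.
Qed.

Lemma measurable_superlevel (R : realType) (d : measure_display)
    (Y : measurableType d) (f : Y -> R) (s : R) :
  measurable_fun setT f -> measurable [set x | s < f x].
Proof.
move=> mf; rewrite -[X in measurable X]setTI.
exact: (measurable_fun_ltr (measurable_cst s) mf measurableT (Y := [set true])).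
Qed.

Lemma measurable_closed_superlevel (R : realType) (d : measure_display)
    (Y : measurableType d) (f : Y -> R) (s : R) :
  measurable_fun setT f -> measurable [set x | s <= f x].
Proof.
move=> mf; rewrite -[X in measurable X]setTI.
exact: (measurable_fun_ler (measurable_cst s) mf measurableT (Y := [set true])).
Qed.

(** Monotonicity is only asked on [D]: near [0] a rearrangement may blow up, so
    that it has no monotone extension to the whole line. *)
Lemma nonincreasing_on_measurable (R : realType) (D : set R) (f : R -> R) :
  is_interval D -> (forall x y, D x -> D y -> x <= y -> f y <= f x) ->
  measurable_fun D f.
Proof.
move=> iD fD; apply: (measurability (@RGenOInfty.G R)) => [|/= _ [_] [r] -> <-].
  exact: RGenOInfty.measurableE.
apply: is_interval_measurable => y z [Dy]; rewrite /= !in_itv/= !andbT => ry.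
move=> [Dz rz] u /andP[yu uz].
have Du : D u by apply: (iD y z) => //; rewrite yu.
by split=> //=; rewrite in_itv/= andbT (lt_le_trans rz)// fD.
Qed.

(** * The decreasing rearrangement *)

Section rearrangement.
Context (R : realType) (d : measure_display) (X : measurableType d).
Variables (mu : probability X R) (w : X -> R).
Hypotheses (w0 : forall x, 0 <= w x) (iw : mu.-integrable setT (EFin \o w)).

Local Notation wstar := (decreasing_rearrangement mu w).

Let mw : measurable_fun setT w.
Proof. exact/measurable_EFinP/(measurable_int _ iw). Qed.

Lemma le_inf_image (e : set X) (s : R) :
  e !=set0 -> (forall x, e x -> s <= w x) -> s <= inf (w @` e).
Proof.
move=> [x ex] se; apply: lb_le_inf; first by exists (w x), x.
by move=> _ [y ey <-]; exact: se.
Qed.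

Lemma inf_image_le (e : set X) (x : X) : e x -> inf (w @` e) <= w x.
Proof.
by move=> ex; apply: ge_inf; [exists 0 => _ [y _ <-]|exists x].
Qed.

Lemma positive_measure_nonempty (e : set X) (t : R) :
  0 < t -> (t%:E <= mu e)%E -> e !=set0.
Proof.
move=> t0 te; apply/set0P/eqP => e0; move: te.
by rewrite e0 measure0 lee_fin leNgt t0.
Qed.

(** Markov's inequality. It also shows that the supremum defining the
    rearrangement is over a bounded set. *)
Lemma inf_image_measure_le (e : set X) (t : R) : 0 < t -> measurable e ->
  (t%:E <= mu e)%E -> inf (w @` e) * t <= fine (\int[mu]_x (w x)%:E)%E.
Proof.
move=> t0 me te.
have [x0 ex0] := positive_measure_nonempty t0 te.
have s0 : 0 <= inf (w @` e) by apply: le_inf_image => //; exists x0.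
rewrite -lee_fin fineK ?(integrable_fin_num _ iw)//.
apply: (@le_trans _ _ (\int[mu]_(x in e) (w x)%:E)%E); last first.
  apply: ge0_subset_integral => //; first exact/measurable_EFinP.
  by move=> x _; rewrite lee_fin.
apply: (@le_trans _ _ (\int[mu]_(x in e) (inf (w @` e))%:E)%E).
  by rewrite integral_cst// EFinM lee_wpmul2l.
apply: ge0_le_integral => //.
- by apply/measurable_EFinP; apply: measurable_funTS.
- by move=> x ex; rewrite lee_fin inf_image_le.
Qed.

Lemma rearrangement_has_sup (t : R) : 0 < t <= 1 ->
  has_sup [set inf (w @` e) | e in [set e | measurable e /\ (t%:E <= mu e)%E]].
Proof.
move=> /andP[t0 t1]; split.
  by exists (inf (w @` setT)), setT => //; split=> //; rewrite probability_setT.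
exists (fine (\int[mu]_x (w x)%:E)%E / t) => _ [e [me te] <-].
by rewrite ler_pdivlMr// inf_image_measure_le.
Qed.

Lemma rearrangement_markov (t : R) : 0 < t <= 1 ->
  wstar t * t <= fine (\int[mu]_x (w x)%:E)%E.
Proof.
move=> t01; have /andP[t0 _] := t01; rewrite -ler_pdivlMr//.
apply: ge_sup; first by case: (rearrangement_has_sup t01).
by move=> _ [e [me te] <-]; rewrite ler_pdivlMr// inf_image_measure_le.
Qed.

Lemma le_rearrangement (e : set X) (t s : R) : 0 < t <= 1 ->
  measurable e -> (t%:E <= mu e)%E -> (forall x, e x -> s <= w x) ->
  s <= wstar t.
Proof.
move=> t01 me te se; have /andP[t0 _] := t01.
apply: (@le_trans _ _ (inf (w @` e))).
  by apply: le_inf_image => //; exact: positive_measure_nonempty te.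
by apply: ub_le_sup; [case: (rearrangement_has_sup t01)|exists e].
Qed.

Lemma rearrangement_ge0 (t : R) : 0 < t <= 1 -> 0 <= wstar t.
Proof.
move=> t01; apply: (le_rearrangement (e := setT)) => //.
by rewrite probability_setT lee_fin; case/andP: t01.
Qed.

Lemma lt_rearrangement (t s : R) : 0 < t <= 1 -> s < wstar t ->
  (t%:E <= mu [set x | (s < w x)%R])%E.
Proof.
move=> t01 /sup_gt[|_ [e [me te] <-] se].
  by case: (rearrangement_has_sup t01).
apply: (le_trans te); apply: le_measure; rewrite ?inE//.
  exact: measurable_superlevel.
by move=> x ex /=; apply: (lt_le_trans se); exact: inf_image_le.
Qed.

Lemma rearrangement_nonincreasing (s t : R) : 0 < s -> s <= t -> t <= 1 ->
  wstar t <= wstar s.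
Proof.
move=> s0 st t1; have t0 := lt_le_trans s0 st; have s1 := le_trans st t1.
apply: ge_sup; first by case: (@rearrangement_has_sup t) => //; rewrite t0.
move=> _ [e [me te] <-].
apply: (le_rearrangement (e := e)); rewrite ?s0//.
  by apply: le_trans te; rewrite lee_fin.
by move=> x ex; exact: inf_image_le.
Qed.

(** If [{w > w*(t)}] had measure more than [t], then so would
    [{w >= w*(t) + 1/n}] for some [n], by continuity from below, and this set
    would witness [w*(t) >= w*(t) + 1/n]. *)
Lemma measure_gt_rearrangement (t : R) : 0 < t <= 1 ->
  (mu [set x | (wstar t < w x)%R] <= t%:E)%E.
Proof.
move=> t01.
pose F n := [set x | wstar t + n.+1%:R^-1 <= w x].
have mF n : measurable (F n) by exact: measurable_closed_superlevel.
have FE : \bigcup_n F n = [set x | wstar t < w x].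
  apply/seteqP; split => x.
    by move=> [n _]; apply: lt_le_trans; rewrite ltrDl invr_gt0.
  move=> /= wx; have wx0 : 0 < w x - wstar t by rewrite subr_gt0.
  exists (Num.truncn (w x - wstar t)^-1) => //=; rewrite /F /= -lerBrDl.
  rewrite invf_ple ?posrE// ltW// truncnS_gt//.
rewrite -FE.
have cF : (mu \o F) n @[n --> \oo] --> mu (\bigcup_n F n).
  apply: nondecreasing_cvg_mu => //; first exact: bigcup_measurable.
  move=> m n mn; apply/subsetPset => x; apply: le_trans.
  by rewrite lerD2l lef_pV2 ?posrE ?ltr0n// ler_nat.
rewrite -(cvg_lim _ cF)//; apply: lime_le; first by apply/cvg_ex; exists (mu (\bigcup_n F n)).
apply: nearW => n /=; rewrite leNgt; apply/negP => /ltW tF.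
have := le_rearrangement t01 (mF n) tF (fun x => id).
by rewrite leNgt ltrDl invr_gt0 ltr0Sn.
Qed.

Lemma measurable_rearrangement (t : R) : t <= 1 ->
  measurable_fun (`]0, t]%classic : set R) wstar.
Proof.
move=> t1; apply: nonincreasing_on_measurable; first exact: interval_is_interval.
move=> y z; rewrite /= !in_itv/= => /andP[y0 _] /andP[_ zt] yz.
by apply: rearrangement_nonincreasing => //; exact: le_trans t1.
Qed.

(** By [lt_rearrangement], the set where [w* > a + s] on [(0, t]] is contained in
    [(0, mu{w > a + s}]], so the tails of the left integrand are below those of
    the right one. *)
Lemma integral_rearrangement_sub_le (t a : R) : 0 < t <= 1 ->
  a <= wstar t ->
  (\int[lebesgue_measure]_(y in `]0%R, t]) (wstar y - a)%:E <=
   \int[mu]_x (Num.max (w x - a) 0)%:E)%E.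
Proof.
move=> t01 at_; have /andP[t0 t1] := t01.
pose D : set (measurableTypeR R) := `]0, t]%classic.
have mD : measurable D by exact: measurable_itv.
have D01 y : D y -> 0 < y <= 1.
  by rewrite /D /= in_itv/= => /andP[-> yt]; exact: le_trans t1.
pose f : measurableTypeR R -> R := (fun y => wstar y - a) \_ D.
have fD y : D y -> f y = wstar y - a by move=> Dy; rewrite /f patchE mem_set.
have fND y : ~ D y -> f y = 0 by move=> Dy; rewrite /f patchE memNset.
have a_le y : D y -> a <= wstar y.
  rewrite /D /= in_itv/= => /andP[y0 yt].
  by apply: (le_trans at_); exact: rearrangement_nonincreasing.
have f0 y : 0 <= f y.
  have [Dy|Dy] := pselect (D y); last by rewrite fND.
  by rewrite fD// subr_ge0 a_le.
have mf : measurable_fun setT f.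
  apply/(measurable_restrictT _ mD) => _.
  by apply: measurable_funB => //; exact: measurable_rearrangement.
pose g x := Num.max (w x - a) 0.
have g0 x : 0 <= g x by rewrite /g le_max lexx orbT.
have mg : measurable_fun setT g.
  by apply: measurable_maxr => //; exact: measurable_funB.
rewrite (_ : (\int[lebesgue_measure]_(y in D) _ = \int[lebesgue_measure]_y (f y)%:E)%E); last first.
  rewrite integral_mkcond; apply: eq_integral => y _ /=.
  by rewrite /f !patchE; case: ifP.
rewrite (layer_cake _ mf f0) (layer_cake _ mg g0).
apply: ge0_le_integral => //.
- by apply: measurable_funTS; exact: measurable_tail.
- by apply: measurable_funTS; exact: measurable_tail.
- move=> s; rewrite /= in_itv/= andbT => s0.
  have mS : measurable [set x | s < g x] by exact: measurable_superlevel.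
  have fin : mu [set x | s < g x] \is a fin_num by exact: fin_num_measure.
  apply: (@le_trans _ _ (lebesgue_measure
      (`]0%R, fine (mu [set x | s < g x])]%classic : set R))); last first.
    rewrite lebesgue_measure_itv/= lte_fin; case: ifPn => // _.
    by rewrite -EFinB subr0 fineK.
  apply: le_measure; rewrite ?inE//.
  - exact: measurable_superlevel.
  move=> y /=; have [Dy|Dy] := pselect (D y); last first.
    by rewrite fND// ltNge s0.
  rewrite fD// ltrBrDr in_itv/= => sy; have /andP[-> _] := D01 _ Dy.
  rewrite -lee_fin fineK//.
  apply: (le_trans (lt_rearrangement (D01 _ Dy) sy)).
  apply: le_measure; rewrite ?inE//; first exact: measurable_superlevel.
  by move=> x /=; rewrite /g lt_max ltrBrDr => ->.
Qed.

Lemma integral_rearrangement_le (t a : R) : 0 < t <= 1 ->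
  0 <= a <= wstar t ->
  (\int[lebesgue_measure]_(y in `]0%R, t]) (wstar y)%:E <=
   (a * t)%:E + \int[mu]_x (Num.max (w x - a) 0)%:E)%E.
Proof.
move=> t01 /andP[a0 at_]; have /andP[t0 t1] := t01.
have mws := measurable_rearrangement t1.
under eq_integral do rewrite -(subrK a (wstar _)) EFinD.
rewrite ge0_integralD//.
- rewrite addeC leeD// ?integral_rearrangement_sub_le//.
  rewrite integral_cst//= lebesgue_measure_itv/= lte_fin t0.
  by rewrite -EFinB subr0 -EFinM.
- move=> y; rewrite /= in_itv/= => /andP[y0 yt].
  rewrite lee_fin subr_ge0 (le_trans at_)//.
  exact: rearrangement_nonincreasing.
- by apply/measurable_EFinP; exact: measurable_funB.
Qed.

End rearrangement.

(** * Integrals over finite disjoint unions *)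

Lemma integral_finite_bigcup (R : realType) (d : measure_display)
    (Y : measurableType d) (m : {measure set Y -> \bar R}) (I : finType)
    (F : I -> set Y) (f : Y -> R) :
  (forall i, measurable (F i)) -> trivIset setT F -> measurable_fun setT f ->
  (\int[m]_(x in \bigcup_i F i) (f x)%:E =
   \sum_i \int[m]_(x in F i) (f x)%:E)%E.
Proof.
move=> mF tF mf.
have enumT : [set` index_enum I] = setT.
  by apply/seteqP; split => i //= _; rewrite mem_index_enum.
rewrite -{1}enumT bigcup_seq integral_bigsetU_EFin//.
- exact: index_enum_uniq.
- by rewrite enumT.
- by apply/measurable_EFinP; exact: measurable_funTS.
Qed.

(** * Trees with indexed children *)

(** The combinatorial content of a homogeneous tree. The children of each cell
    are enumerated by ['I_k], so that sums over children are finite sums; the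
    level structure is reflected in the last clause, which separates the whole
    space from the cells below its children. *)
Definition child_map (R : realType) (d : measure_display)
    (X : measurableType d) (mu : probability X R) (k : nat) (T : set (set X))
    (F : set X -> 'I_k -> set X) : Prop :=
  [/\ T setT,
      forall I, T I -> measurable I,
      forall I, T I -> [/\ forall i, T (F I i),
          trivIset setT (F I),
          I = \bigcup_i F I i &
          forall i, mu (F I i) = ((k%:R^-1)%:E * mu I)%E] &
      forall I, T I -> I = setT \/ exists i, I `<=` F setT i].

Lemma homogeneous_tree_child_map (R : realType) (d : measure_display)
    (X : measurableType d) (mu : probability X R) (k : nat) (T : set (set X)) :
  homogeneous_tree mu k T -> exists F, @child_map R d X mu k T F.
Proof.
move=> [mT [C [hC TE]] _].
have TT : T setT by rewrite TE; exists 0%N.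
have [F0 hF0] : {F : set X -> nat -> set X &
    forall I, T I -> set_bij `I_k (C I) (F I)}.
  apply: (@choice _ _ (fun I g => T I -> set_bij `I_k (C I) g)) => I.
  have [TI|] := pselect (T I); last by exists (fun=> set0).
  have [_ + _ _ _] := hC I TI.
  by rewrite card_eq_sym => /card_set_bijP[g hg]; exists g.
pose F I (i : 'I_k) := F0 I i.
have FC I i : T I -> C I (F I i).
  by move=> TI; have [+ _ _] := hF0 I TI; apply => /=.
have CF I J : T I -> C I J -> exists i, J = F I i.
  move=> TI CJ; have [_ _ /(_ J CJ)[i /= ik <-]] := hF0 I TI.
  by exists (Ordinal ik).
exists F; split => // [I TI|I].
  have [CT _ dC UC mC] := hC I TI; split.
  - by move=> i; apply: CT; exact: FC.
  - apply/trivIsetP => i j _ _ ij; apply: dC; [exact: FC|exact: FC|].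
    move=> FE; have [_ inj _] := hF0 I TI; move/eqP: ij; apply.
    by apply/val_inj/inj => //; rewrite inE /=.
  - rewrite {1}UC; apply/seteqP; split => x [].
      by move=> J /(CF _ _ TI)[i ->]; exists i.
    by move=> i _ Fx; exists (F I i) => //; exact: FC.
  - by move=> i; apply: mC; exact: FC.
rewrite TE => -[m _ Im]; have TI : T I by rewrite TE; exists m.
suff H : forall n J, tree_level C n.+1 J -> exists i, J `<=` F setT i.
  by case: m Im => [->|n Im]; [left|right; exact: (H n)].
elim=> [|n IH] J [K].
  by move=> /= -> CJ; have [i ->] := CF _ _ TT CJ; exists i.
move=> /= Kn CJ; have TK : T K by rewrite TE; exists n.+1.
have [i KF] := IH K Kn; exists i; apply: subset_trans KF.
by have [_ _ _ -> _] := hC K TK; exact: bigcup_sup.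
Qed.

(** * The stopping-time estimate *)

Section A1_excess.
Context (R : realType) (d : measure_display) (X : measurableType d).
Variables (mu : probability X R) (k : nat) (T : set (set X)).
Variable F : set X -> 'I_k -> set X.
Variables (w : X -> R) (c : R).
Hypotheses (k2 : (2 <= k)%N) (hF : child_map mu T F).
Hypotheses (w0 : forall x, 0 <= w x) (iw : mu.-integrable setT (EFin \o w)).
Hypotheses (c1 : 1 <= c) (hc : A1_bound mu T w c).

Local Notation W A := (\int[mu]_(x in A) w x).
Local Notation m A := (fine (mu A)).
Local Notation K := (k%:R * c - k%:R + 1).

Let mw : measurable_fun setT w.
Proof. exact/measurable_EFinP/(measurable_int _ iw). Qed.

Let mT I : T I -> measurable I. Proof. by case: hF => _ + _ _; apply. Qed.

Let TF I i : T I -> T (F I i).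
Proof. by case: hF => _ _ + _ => /[apply] -[]. Qed.

Let iwS A : measurable A -> mu.-integrable A (EFin \o w).
Proof. by move=> mA; exact: integrableS iw. Qed.

Let WE A : measurable A -> (\int[mu]_(x in A) (w x)%:E)%E = (W A)%:E.
Proof. by move=> mA; rewrite /Rintegral fineK// (integrable_fin_num _ (iwS mA)). Qed.

Let mE A : measurable A -> mu A = (m A)%:E.
Proof. by move=> mA; rewrite fineK// fin_num_measure. Qed.

Let W_ge0 A : 0 <= W A.
Proof. by apply/fine_ge0/integral_ge0 => x _; rewrite lee_fin. Qed.

Let m_ge0 A : 0 <= m A. Proof. exact/fine_ge0. Qed.

Let W_null A : measurable A -> m A = 0 -> W A = 0.
Proof.
move=> mA mA0; have muA0 : mu A = 0 by rewrite mE// mA0.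
rewrite /Rintegral null_set_integral//.
by apply/measurable_EFinP; exact: measurable_funTS.
Qed.

Let integral_subE A b : measurable A ->
  (\int[mu]_(x in A) (w x - b)%:E)%E = (W A - b * m A)%:E.
Proof.
move=> mA; under eq_integral do rewrite EFinB.
rewrite integralB_EFin//; last 2 first.
- exact: iwS.
- exact: finite_measure_integrable_cst.
by rewrite WE// integral_cst// EFinB EFinM -mE.
Qed.

Let averageE I : T I -> average mu (fun y => `|w y|) I = ((m I)^-1 * W I)%:E.
Proof.
move=> TI; rewrite /average EFinM -WE; last exact: mT.
by congr (_ * _)%E; apply: eq_integral => x _; rewrite ger0_norm.
Qed.

Let c_ge0 : 0 <= c. Proof. by case: hc. Qed.

(** One null set serves all cells at once, because the maximal function is a
    supremum over cells. *)
Lemma ae_average_le :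
  {ae mu, forall x, forall I, T I -> I x -> (m I)^-1 * W I <= c * w x}.
Proof.
case: hc => _; apply: filterS => x Mx I TI Ix; rewrite -lee_fin -averageE//.
by apply: le_trans Mx; apply: ereal_sup_ubound; exists I.
Qed.

(** Integrating the A1 inequality over a part [J] of the cell [I]. *)
Lemma average_subset_le I J : T I -> J `<=` I -> measurable J ->
  (m I)^-1 * W I * m J <= c * W J.
Proof.
move=> TI JI mJ; rewrite -lee_fin.
have -> : ((m I)^-1 * W I * m J)%:E =
    (\int[mu]_(x in J) ((m I)^-1 * W I)%:E)%E.
  by rewrite integral_cst// EFinM -mE.
have -> : (c * W J)%:E = (\int[mu]_(x in J) (c * w x)%:E)%E.
  under [RHS]eq_integral do rewrite EFinM.
  rewrite ge0_integralZl_EFin ?WE//.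
    by move=> x _; rewrite lee_fin.
  by apply/measurable_EFinP; exact: measurable_funTS.
apply: ae_ge0_le_integral => //.
- by move=> x _; rewrite lee_fin mulr_ge0// invr_ge0.
- by move=> x _; rewrite lee_fin mulr_ge0.
- apply/measurable_EFinP; apply: measurable_funM => //.
  exact: measurable_funTS.
by move: ae_average_le; apply: filterS => x h Jx; rewrite lee_fin h//; exact: JI.
Qed.

Lemma child_measure I i : T I -> m (F I i) = m I / k%:R.
Proof.
move=> TI; case: hF => _ _ /(_ _ TI)[_ _ _ +] _ => /(_ i).
move=> ->; rewrite fineM ?fin_num_measure//; last exact: mT.
by rewrite mulrC.
Qed.

Lemma child_subset I i : T I -> F I i `<=` I.
Proof.
move=> TI x Fx; have [_ _ /(_ _ TI)[_ _ IE _] _] := hF.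
by rewrite IE; exists i.
Qed.

Lemma child_integral_ge I i : T I -> W I / k%:R <= c * W (F I i).
Proof.
move=> TI; have [m0|m0] := eqVneq (m I) 0.
  by rewrite (W_null (mT TI) m0) mul0r mulr_ge0.
have := average_subset_le TI (child_subset (i := i) TI) (mT (TF i TI)).
by rewrite child_measure// mulrA (mulrAC _ _ (m I)) mulVf// mul1r.
Qed.

Lemma integral_children I : T I -> W I = \sum_i W (F I i).
Proof.
move=> TI; have [_ _ /(_ _ TI)[_ tF IE _] _] := hF.
apply: EFin_inj; rewrite -WE; last exact: mT.
rewrite {1}IE integral_finite_bigcup//; last by move=> i; exact/mT/TF.
rewrite -sumEFin; apply: eq_bigr => i _; rewrite WE//; exact/mT/TF.
Qed.

(** The source of the sharp constant. Each sibling of the child carries at least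
    [W I / (k c)] by the A1 condition, so at most
    [W I - (k - 1) W I / (k c) = (K / (k c)) W I] is left for the child. *)
Lemma child_integral_le I j a : T I -> W I <= c * a * m I ->
  W (F I j) <= K * a * m (F I j).
Proof.
move=> TI WI; have k0 : 0 < k%:R :> R by rewrite ltr0n (leq_trans _ k2).
have c0 : 0 < c by exact: lt_le_trans c1.
have sib : W (F I j) + \sum_(i | i != j) W (F I i) = W I.
  by rewrite (integral_children TI) [RHS](bigD1 j).
have : \sum_(i | i != j) W I / k%:R <= c * \sum_(i | i != j) W (F I i).
  by rewrite mulr_sumr; apply: ler_sum => i _; exact: child_integral_ge.
rewrite sumr_const cardC1 card_ord -[_ *+ _]mulr_natr -subn1 natrB ?(leq_trans _ k2)//.
move=> sib_ge; rewrite child_measure//.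
have K0 : 0 <= K by rewrite -[X in _ - X]mulr1 -mulrBr addr_ge0// mulr_ge0 ?subr_ge0// ltW.
rewrite -(ler_pM2l c0).
apply: (@le_trans _ _ (W I * (K / k%:R))).
  have -> : W I * (K / k%:R) = c * W I - W I / k%:R * (k%:R - 1).
    by field; rewrite gt_eqF.
  by rewrite lerBrDr -[in c * W I]sib [leRHS]mulrDr lerD2l.
have -> : c * (K * a * (m I / k%:R)) = (c * a * m I) * (K / k%:R) by ring.
by rewrite ler_wpM2r// divr_ge0// ltW.
Qed.

Variable a : R.
Hypothesis a0 : 0 <= a.

Let high (I : set X) := c * a * m I < W I.

(** The points of [I] that lie in a high proper descendant of [I] (one where the
    mean of [w] exceeds [c a]) at depth at most [n]. The recursion does not look below a high child, so the set is the
    disjoint union of the first high cells met from [I] downwards, within depth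
    [n]. *)
Fixpoint stopped (n : nat) (I : set X) : set X :=
  if n is p.+1 then
    \bigcup_(i : 'I_k) (if high (F I i) then F I i else stopped p (F I i))
  else set0.

Lemma stopped_subset n I : T I -> stopped n I `<=` I.
Proof.
elim: n I => [|n IH] I TI x; first by [].
case=> i _; case: ifPn => _ Fx.
  exact: child_subset Fx.
by apply: (child_subset (i := i) TI); apply: IH Fx; exact: TF.
Qed.

Lemma measurable_stopped n I : T I -> measurable (stopped n I).
Proof.
elim: n I => [|n IH] I TI; first exact: measurable0.
apply: fin_bigcup_measurable => [|i _]; first exact: finite_finset.
case: ifPn => _; first exact/mT/TF.
by apply: IH; exact: TF.
Qed.

Lemma stopped_nondecreasing n I : stopped n I `<=` stopped n.+1 I.
Proof.
elim: n I => [|n IH] I x; first by [].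
case=> i _ Fx; exists i => //; move: Fx.
by case: ifPn => // _; exact: IH.
Qed.

Lemma stopped_high n I x : T I -> stopped n I x ->
  exists J, [/\ T J, J x & high J].
Proof.
elim: n I => [|n IH] I TI; first by [].
case=> i _; case: ifPn => hi Fx.
  by exists (F I i); split=> //; exact: TF.
by apply: IH Fx; exact: TF.
Qed.

(** The estimate is additive over the children, so that induction on the depth
    replaces the enumeration of all stopping cells: a high child has a low
    parent and is handled by [child_integral_le], a low one by induction. *)
Lemma integral_stopped_le n I : T I -> W I <= c * a * m I ->
  W (stopped n I) <= K * a * m (stopped n I).
Proof.
move=> TI WI; rewrite -subr_le0 -lee_fin -integral_subE; last first.
  exact: measurable_stopped.
elim: n I TI WI => [|n IH] I TI WI; first by rewrite integral_set0.
rewrite integral_finite_bigcup; last 3 first.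
- move=> i; case: ifPn => _; first exact/mT/TF.
  exact/measurable_stopped/TF.
- have [_ _ /(_ _ TI)[_ tF _ _] _] := hF.
  move/trivIsetP : tF => tF; apply/trivIsetP => i j _ _ ij.
  have S l : (if high (F I l) then F I l else stopped n (F I l)) `<=` F I l.
    by case: ifPn => _; [exact: subset_refl|exact: stopped_subset (TF l TI)].
  apply/seteqP; split=> // x [/S Fi /S Fj].
  by have /seteqP[/(_ x) + _] := tF i j Logic.I Logic.I ij; apply.
- exact: measurable_funB.
apply: sume_le0 => i _; case: ifPn => [_|].
  rewrite integral_subE ?lee_fin ?subr_le0; last exact/mT/TF.
  exact: child_integral_le.
by rewrite /high -leNgt => hi; apply: IH => //; exact: TF.
Qed.

(** A point that is never stopped lies in low cells of every depth, which shrink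
    to it; this feeds the differentiation property. *)
Lemma not_stopped_low n I x : T I -> W I <= c * a * m I -> I x ->
  ~ stopped n I x ->
  exists J, [/\ T J, J x, W J <= c * a * m J & m J = m I / k%:R ^+ n].
Proof.
elim: n I => [|n IH] I TI WI Ix nx.
  by exists I; rewrite expr0 divr1.
have [_ _ /(_ _ TI)[_ _ IE _] _] := hF.
move: (Ix); rewrite {1}IE => -[i _ Fx].
have nS : ~ (if high (F I i) then F I i else stopped n (F I i)) x.
  by move=> Sx; apply: nx; exists i.
move: nS; case: ifPn => // hi nS.
have [|J [TJ Jx WJ mJ]] := IH _ (TF i TI) _ Fx nS; first by rewrite leNgt.
exists J; split=> //; rewrite mJ child_measure// exprS invfM; ring.
Qed.

Hypothesis hD : differentiates_L1 mu T.
Hypothesis WT : W setT <= c * a * m setT.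

Let TT : T setT. Proof. by case: hF. Qed.

Lemma ae_not_stopped_le :
  {ae mu, forall x, (forall n, ~ stopped n setT x) -> w x <= c * a}.
Proof.
move: (hD iw); apply: filterS => x Dx nx.
have /choice[I hI] n := not_stopped_low TT WT Logic.I (nx n).
have mI : mu (I j) @[j --> \oo] --> 0%E.
  rewrite (_ : (fun j => mu (I j)) = (fun j => (k%:R^-1 ^+ j)%:E)).
    apply: cvg_EFin; first by near=> j.
    apply: cvg_expr; rewrite normfV ger0_norm// invf_lt1 ?ltr1n//.
    by rewrite ltr0n (leq_trans _ k2).
  apply/funext => j; have [TI _ _ mI] := hI j; rewrite mE; last exact: mT.
  by rewrite mI exprVn probability_setT div1r.
have := Dx I (fun j => let: And4 TI Ix _ _ := hI j in conj TI Ix) mI.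
move=> av; rewrite -lee_fin -(cvg_lim _ av)//.
apply: lime_le; first by apply/cvg_ex; exists (w x)%:E.
apply: nearW => j; have [TI _ WI _] := hI j.
rewrite /average WE; last exact: mT.
rewrite -EFinM lee_fin; have [m0|m0] := eqVneq (m (I j)) 0.
  by rewrite m0 invr0 mul0r mulr_ge0.
by rewrite mulrC ler_pdivrMr// lt0r m0 m_ge0.
Unshelve. all: by end_near. Qed.

Lemma ae_stopped_gt : {ae mu, forall x n, stopped n setT x -> a < w x}.
Proof.
move: ae_average_le; apply: filterS => x h n /(stopped_high TT)[J [TJ Jx hJ]].
have m0 : 0 < m J.
  rewrite lt0r m_ge0 andbT; apply/eqP => m0; move: hJ.
  by rewrite /high m0 mulr0 (W_null (mT TJ) m0) ltxx.
have c0 : 0 < c by exact: lt_le_trans c1.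
rewrite -(ltr_pM2l c0); apply: lt_le_trans (h J TJ Jx).
by rewrite [ltRHS]mulrC ltr_pdivlMr.
Qed.

(** On the union [E] of the stopped sets, [w > a] and the integral of [w] is at
    most [K a mu(E)]; off [E], [(w - a)^+ <= (c - 1) a <= (K - 1) a] with support
    in [{w > a}]. The two parts add up because [E] is contained in [{w > a}] up
    to a null set. *)
Lemma excess_integral_le :
  (\int[mu]_x (Num.max (w x - a) 0)%:E <=
   ((K - 1) * a)%:E * mu [set x | (a < w x)%R])%E.
Proof.
set P := [set x | a < w x]; pose f x := Num.max (w x - a) 0.
pose E := \bigcup_n stopped n setT.
have mS n : measurable (stopped n setT) by exact: measurable_stopped.
have mE' : measurable E by exact: bigcup_measurable.
have mP : measurable P by exact: measurable_superlevel.
have f0 x : 0 <= f x by rewrite /f le_max lexx orbT.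
have mf : measurable_fun setT f.
  by apply: measurable_maxr => //; exact: measurable_funB.
have cK : c <= K by move: k2 c1; rewrite -(ler_nat R) => *; nra.
have K1 : 0 <= K - 1 by rewrite subr_ge0 (le_trans c1 cK).
have Ka0 : 0 <= (K - 1) * a by exact: mulr_ge0.
have int_stopped n : (\int[mu]_(x in stopped n setT) (f x)%:E <=
    ((K - 1) * a)%:E * mu E)%E.
  rewrite (@ae_eq_integral _ _ _ mu _ (fun x => (w x - a)%:E)); last 4 first.
  - exact: mS.
  - by apply/measurable_EFinP; exact: measurable_funTS.
  - by apply/measurable_EFinP/measurable_funTS; exact: measurable_funB.
  - move: ae_stopped_gt; apply: filterS => x h Sx; congr EFin.
    by rewrite /f max_l// subr_ge0 ltW// (h n).
  rewrite integral_subE// (mE mE') -EFinM lee_fin.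
  apply: (@le_trans _ _ ((K - 1) * a * m (stopped n setT))).
    by have := integral_stopped_le n TT WT; lra.
  rewrite ler_wpM2l// -lee_fin -!mE//; apply: le_measure; rewrite ?inE//.
  by move=> x Sx; exists n.
have intE : (\int[mu]_(x in E) (f x)%:E <= ((K - 1) * a)%:E * mu E)%E.
  have cvgE : (\int[mu]_(x in stopped n setT) (f x)%:E)%E @[n --> \oo] -->
      (\int[mu]_(x in E) (f x)%:E)%E.
    apply: ge0_nondecreasing_set_cvg_integral => //.
    - apply/nondecreasing_seqP => n; apply/subsetPset.
      exact: stopped_nondecreasing.
    - by move=> n; apply/measurable_EFinP; exact: measurable_funTS.
    - by move=> n x _; rewrite lee_fin.
  rewrite -(cvg_lim _ cvgE)//; apply: lime_le; last exact: nearW.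
  by apply/cvg_ex; exists (\int[mu]_(x in E) (f x)%:E)%E.
have muE : (mu E <= mu (P `&` E))%E.
  rewrite (measureDI _ mE' mP) setIC -[leRHS]add0e leeD2r//.
  rewrite le_eqVlt; apply/orP; left; apply/eqP.
  apply/negligibleP; first exact: measurableD.
  apply: negligibleS ae_stopped_gt => x [[n _ Sx] nPx] /= h.
  exact/nPx/(h n).
have intEC : (\int[mu]_(x in ~` E) (f x)%:E <=
    ((K - 1) * a)%:E * mu (P `\` E))%E.
  rewrite setDE -(integral_indic _ (measurableC mE') mP).
  rewrite -ge0_integralZl_EFin//; last 2 first.
  - exact: measurableC.
  - by apply/measurable_EFinP; exact: measurable_indic.
  apply: ae_ge0_le_integral => //.
  - exact: measurableC.
  - by move=> x _; rewrite lee_fin.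
  - by apply/measurable_EFinP; exact: measurable_funTS.
  - by move=> x _; rewrite -EFinM lee_fin mulr_ge0.
  - by apply/measurable_EFinP; exact: measurable_funM.
  move: ae_not_stopped_le; apply: filterS => x h nEx.
  have {}h : w x <= c * a by apply: h => n Sx; apply: nEx; exists n.
  rewrite -EFinM lee_fin indicE /f; have [Px|nPx] := boolP (x \in P).
    rewrite mulr1 ge_max Ka0 andbT.
    by move: h a0 cK => *; nra.
  rewrite mulr0 ge_max lexx andbT subr_le0.
  by move: nPx; rewrite notin_setE leNgt => /negP.
rewrite -(setvU E) ge0_integral_setU//; last 4 first.
- exact: measurableC.
- by rewrite setvU; apply/measurable_EFinP.
- by move=> x _; rewrite lee_fin; exact: f0.
- by rewrite disj_set2E setICl.
rewrite (measureDI _ mP mE') muleDr ?fin_num_adde_defl//.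
  apply: leeD => //; apply: (le_trans intE).
  by rewrite lee_wpmul2l.
by rewrite fin_num_measure//; exact: measurableI.
Qed.

End A1_excess.

(** * The upper bound *)

Section upper_bound.
Context (R : realType) (d : measure_display) (X : measurableType d).
Variables (mu : probability X R) (k : nat) (T : set (set X)).
Variable F : set X -> 'I_k -> set X.
Variables (w : X -> R) (c : R).
Hypotheses (k2 : (2 <= k)%N) (hF : child_map mu T F).
Hypotheses (hD : differentiates_L1 mu T).
Hypotheses (w0 : forall x, 0 <= w x) (iw : mu.-integrable setT (EFin \o w)).
Hypotheses (hc : A1_bound mu T w c).

Local Notation W := (\int[mu]_x w x).
Local Notation wstar := (decreasing_rearrangement mu w).

Let TT : T setT. Proof. by case: hF. Qed.

Let fine1 : fine (mu setT) = 1 :> R. Proof. by rewrite probability_setT. Qed.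

Lemma A1_constant_ge1 : 0 < W -> 1 <= c.
Proof.
move=> W_gt0; have := average_subset_le hF w0 iw hc TT (@subset_refl _ _) measurableT.
by rewrite fine1 invr1 mul1r mulr1 ler_pMl.
Qed.

(** The whole space is a low cell at height [c w*(t)]: the A1 condition on [X]
    says that [w] is at least [W / c] almost everywhere. *)
Lemma integral_le_rearrangement (t : R) : 0 < W -> 0 < t <= 1 ->
  W <= c * wstar t.
Proof.
move=> W_gt0 t01; have /andP[t0 t1] := t01.
have c0 : 0 < c by apply: lt_le_trans (A1_constant_ge1 W_gt0).
have mw : measurable_fun setT w by exact/measurable_EFinP/(measurable_int _ iw).
pose e := [set x | W / c <= w x].
have me : measurable e by exact: measurable_closed_superlevel.
have mue : mu e = 1%E.
  have nC : mu (~` e) = 0%E.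
    apply/negligibleP; first exact: measurableC.
    apply: negligibleS (ae_average_le hF w0 iw hc) => x ne h; apply: ne.
    have := h setT TT Logic.I.
    by rewrite fine1 invr1 mul1r /e /= ler_pdivrMr// mulrC.
  have := probability_setC mu (measurableC me).
  by rewrite setCK nC sube0.
rewrite mulrC -ler_pdivrMr//; apply: (le_rearrangement w0 iw t01 me) => //.
by rewrite mue lee_fin.
Qed.

Lemma A1_rearrangement_bound :
  rearrangement_bound mu w (k%:R * c - k%:R + 1).
Proof.
move=> t t01; have /andP[t0 t1] := t01; set K := _ + 1.
have W_ge0 : 0 <= W by apply: Rintegral_ge0.
(* If [w] vanishes almost everywhere, [c] may be less than [1] and the constant
   may be negative, but then both sides are [0]. *)
have [W0|W_neq0] := eqVneq W 0.
  have ws0 y : 0 < y <= 1 -> wstar y = 0.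
    move=> y01; have /andP[y0 _] := y01; apply/eqP.
    rewrite eq_le rearrangement_ge0// andbT.
    by have := rearrangement_markov w0 iw y01; rewrite -/W W0 pmulr_lle0.
  rewrite (ws0 _ t01) mulr0 (eq_integral (cst 0%E)) ?integral0 ?mule0// => y.
  rewrite inE /= in_itv/= => /andP[y0 yt]; rewrite ws0// y0.
  exact: le_trans t1.
have W_gt0 : 0 < W by rewrite lt0r W_neq0.
have c1 := A1_constant_ge1 W_gt0.
set a := wstar t; have a0 : 0 <= a by exact: rearrangement_ge0.
rewrite muleC lee_pdivrMr// -EFinM.
have a01 : 0 <= a <= wstar t by rewrite a0 lexx.
apply: (le_trans (integral_rearrangement_le w0 iw t01 a01)).
have -> : (K * a * t)%:E = ((a * t)%:E + ((K - 1) * a)%:E * t%:E)%E.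
  by rewrite -EFinM -EFinD; congr EFin; ring.
rewrite leeD2l//; apply: (le_trans (excess_integral_le k2 hF w0 iw c1 hc a0 hD _)).
  by rewrite fine1 mulr1 integral_le_rearrangement.
rewrite lee_wpmul2l//; last exact: measure_gt_rearrangement.
have kR : 0 <= k%:R :> R by [].
rewrite lee_fin mulr_ge0// /K addrK -[X in _ - X]mulr1 -mulrBr.
by rewrite mulr_ge0// subr_ge0.
Qed.

End upper_bound.

(** * Sharpness *)

Section sharpness.
Context (R : realType) (d : measure_display) (X : measurableType d).
Variables (mu : probability X R) (k : nat) (T : set (set X)).
Variable F : set X -> 'I_k -> set X.
Variables (j : 'I_k) (c : R).
Hypotheses (k2 : (2 <= k)%N) (hF : child_map mu T F) (c1 : 1 <= c).

Local Notation K := (k%:R * c - k%:R + 1).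
Local Notation J := (F setT j).

Definition two_valued_weight (x : X) : R := 1 + (K - 1) * \1_J x.
Local Notation w := two_valued_weight.

Let TT : T setT. Proof. by case: hF. Qed.

Let mT I : T I -> measurable I. Proof. by case: hF => _ + _ _; apply. Qed.

Let mJ : measurable J.
Proof. by apply: mT; case: hF => _ _ /(_ _ TT)[+ _ _ _] _; apply. Qed.

Let muJ : mu J = (k%:R^-1)%:E.
Proof.
case: hF => _ _ /(_ _ TT)[_ _ _ /(_ j) ->] _.
by rewrite probability_setT mule1.
Qed.

Let k_gt1 : 1 < k%:R :> R. Proof. by rewrite ltr1n. Qed.

Let k_gt0 : 0 < k%:R :> R. Proof. exact: lt_trans k_gt1. Qed.

Let cK : c <= K. Proof. by move: k_gt1 c1 => *; nra. Qed.

Let K1 : 1 <= K. Proof. exact: le_trans cK. Qed.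

Let w_in x : J x -> w x = K.
Proof. by move=> Jx; rewrite /w indicE mem_set// mulr1 addrC subrK. Qed.

Let w_out x : ~ J x -> w x = 1.
Proof. by move=> Jx; rewrite /w indicE memNset// mulr0 addr0. Qed.

Let w_ge1 x : 1 <= w x.
Proof.
have [Jx|Jx] := pselect (J x); last by rewrite w_out.
by rewrite w_in.
Qed.

Let w_ge0 x : 0 <= w x. Proof. exact: le_trans (w_ge1 x). Qed.

Let mw : measurable_fun setT w.
Proof. by apply: measurable_funD => //; exact: measurable_funM. Qed.

Let iw : mu.-integrable setT (EFin \o w).
Proof.
apply: (@le_integrable _ _ _ _ _ _ _ (EFin \o cst K)) => //.
- exact/measurable_EFinP.
- move=> x _ /=; rewrite lee_fin !ger0_norm//; last exact: le_trans K1.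
  have [Jx|Jx] := pselect (J x); last by rewrite w_out.
  by rewrite w_in.
- exact: finite_measure_integrable_cst.
Qed.

(** The value [K] on the child is chosen to make this mean equal to [c]. *)
Lemma integral_two_valued_weight : (\int[mu]_x (w x)%:E = c%:E)%E.
Proof.
under eq_integral do rewrite EFinD EFinM.
rewrite ge0_integralD//; last 2 first.
- by move=> x _; rewrite -EFinM lee_fin mulr_ge0// subr_ge0.
- by apply/measurable_EFinP; apply: measurable_funM.
rewrite integral_cst// ge0_integralZl_EFin//; last 2 first.
- by apply/measurable_EFinP.
- by rewrite subr_ge0.
have -> : (\int[mu]_x (\1_J x)%:E = (k%:R^-1)%:E)%E.
  by rewrite integral_indic// setIT; exact: muJ.
rewrite [X in (_ * X)%E]probability_setT mule1 -EFinM -EFinD.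
by congr EFin; field; rewrite gt_eqF.
Qed.

Let average_le I (M : R) : T I -> 0 <= M -> (forall x, I x -> w x <= M) ->
  (average mu (fun y => `|w y|%R) I <= M%:E)%E.
Proof.
move=> TI M0 wM; have mI := mT TI.
have mu_fin : mu I \is a fin_num by exact: fin_num_measure.
have [m0|m0] := eqVneq (fine (mu I)) 0.
  by rewrite /average m0 invr0 mul0e lee_fin.
rewrite /average muleC lee_pdivrMr ?lt0r ?m0 ?fine_ge0//.
rewrite fineK// -integral_cst//; apply: ge0_le_integral => //.
- by apply/measurable_EFinP/measurable_funTS; exact: measurableT_comp.
- by move=> x Ix; rewrite lee_fin ger0_norm// wM.
Qed.

Let average_setT : average mu (fun y => `|w y|%R) setT = c%:E.
Proof.
rewrite /average probability_setT invr1 mul1e -integral_two_valued_weight.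
by apply: eq_integral => x _; rewrite ger0_norm.
Qed.

(** Only the whole space mixes the two values of [w]: every other cell lies in
    one child of [X], where [w] is constant. So the maximal function equals [c]
    where [w = 1], and nothing smaller than [c] works there. *)
Lemma two_valued_weight_A1 : A1_weight mu T w /\ A1_constant mu T w c.
Proof.
have c0 : 0 <= c by exact: le_trans c1.
have bound : A1_bound mu T w c.
  split=> //; apply: aeW => x; apply: ge_ereal_sup => _ [I [TI Ix] <-].
  have [Jx|nJx] := pselect (J x).
    apply: (@le_trans _ _ K%:E); last by rewrite w_in// lee_fin ler_peMl// (le_trans _ K1).
    apply: average_le => // [|y _]; first exact: le_trans K1.
    have [Jy|Jy] := pselect (J y); last by rewrite w_out.
    by rewrite w_in.
  rewrite w_out// mulr1; case: hF => _ _ _ /(_ I TI)[->|[i IF]].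
    by rewrite average_setT.
  apply: (@le_trans _ _ 1%:E); last by rewrite lee_fin.
  apply: average_le => // y Iy; rewrite w_out// => Jy.
  have ij : i != j by apply/eqP => ij; apply: nJx; rewrite -ij; exact: IF.
  have [_ _ /(_ _ TT)[_ /trivIsetP tF _ _] _] := hF.
  have /seteqP[/(_ y) + _] := tF i j Logic.I Logic.I ij.
  by apply; split=> //; exact: IF.
split; first by split=> //; exists c.
split=> // C [C0 hC].
suff [x [nJx hx]] : exists x, ~ J x /\ (tree_maximal mu T w x <= (C * w x)%:E)%E.
  move: hx; rewrite w_out// mulr1 -lee_fin; apply: le_trans.
  by rewrite -average_setT; apply: ereal_sup_ubound; exists setT.
apply: contrapT => nex.
have : mu (~` J) = 0%E.
  apply/negligibleP; first exact: measurableC.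
  by apply: negligibleS hC => x nJx hx; apply: nex; exists x.
rewrite probability_setC// muJ => /eqP; rewrite -EFinB eqe subr_eq0 eq_sym.
by rewrite invr_eq1 gt_eqF.
Qed.

Lemma two_valued_rearrangement_ge (t : R) : 0 < t <= k%:R^-1 ->
  K <= decreasing_rearrangement mu w t.
Proof.
move=> /andP[t0 tk]; apply: (le_rearrangement w_ge0 iw (e := J)) => //.
- by rewrite t0 (le_trans tk)// invf_le1// ltW.
- by rewrite muJ lee_fin.
- by move=> x Jx; rewrite w_in.
Qed.

Lemma two_valued_rearrangement_eq1 (t : R) : k%:R^-1 < t <= 1 ->
  decreasing_rearrangement mu w t = 1.
Proof.
move=> /andP[kt t1]; have t0 : 0 < t by rewrite (lt_trans _ kt)// invr_gt0.
have t01 : 0 < t <= 1 by rewrite t0.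
apply/eqP; rewrite eq_le; apply/andP; split; last first.
  apply: (le_rearrangement w_ge0 iw t01 measurableT) => //.
  by rewrite probability_setT lee_fin.
apply: ge_sup; first by case: (rearrangement_has_sup w_ge0 iw t01).
move=> _ [e [me te] <-].
have [x ex nJx] : exists2 x, e x & ~ J x.
  apply: contrapT => nex.
  have : (mu e <= mu J)%E.
    apply: le_measure; rewrite ?inE// => x ex.
    by apply: contrapT => nJx; apply: nex; exists x.
  by rewrite leNgt muJ (lt_le_trans _ te)// lte_fin.
by rewrite -(w_out nJx); exact: inf_image_le.
Qed.

(** A bound with constant [L] gives [K / k <= L t] for every [t] in [(1/k, 1]],
    since [w* >= K] on [(0, 1/k]] and [w*(t) = 1]; as [t] decreases to [1/k] this
    forces [K <= L]. *)
Lemma two_valued_weight_not_bound (L : R) : L < K ->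
  ~ rearrangement_bound mu w L.
Proof.
move=> LK bnd.
have le_all t : k%:R^-1 < t <= 1 -> K / k%:R <= L * t.
  move=> kt1; have /andP[kt t1] := kt1.
  have t0 : 0 < t by rewrite (lt_trans _ kt)// invr_gt0.
  have := bnd t; rewrite t0 t1 => /(_ isT).
  rewrite two_valued_rearrangement_eq1// mulr1 muleC lee_pdivrMr// -EFinM.
  rewrite -lee_fin; apply: le_trans.
  have ws0 y : `]0, t]%classic y -> 0 <= decreasing_rearrangement mu w y.
    rewrite /= in_itv/= => /andP[y0 yt]; apply: rearrangement_ge0 => //.
    by rewrite y0 (le_trans yt).
  have sub : (`]0, k%:R^-1]%classic : set R) `<=` `]0, t]%classic.
    by move=> y; rewrite /= !in_itv/= => /andP[-> yk]; rewrite (le_trans yk)// ltW.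
  apply: (@le_trans _ _ (\int[lebesgue_measure]_(y in `]0%R, k%:R^-1%R])
      (decreasing_rearrangement mu w y)%:E)%E); last first.
    apply: ge0_subset_integral => //.
    by apply/measurable_EFinP; exact: measurable_rearrangement.
  apply: (@le_trans _ _ (\int[lebesgue_measure]_(y in `]0%R, k%:R^-1%R]) K%:E)%E).
    rewrite integral_cst//= lebesgue_measure_itv/= lte_fin invr_gt0 k_gt0.
    by rewrite -EFinB subr0 -EFinM.
  apply: ge0_le_integral => //.
  - by move=> y _; rewrite lee_fin (le_trans _ K1).
  - apply/measurable_EFinP; apply: measurable_rearrangement => //.
    by rewrite invf_le1// ltW.
  - move=> y; rewrite /= in_itv/= => yk.
    by rewrite lee_fin two_valued_rearrangement_ge.
have k1 : k%:R^-1 < 1 :> R by rewrite invf_lt1.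
have L0 : 0 < L.
  have := le_all 1; rewrite k1 lexx mulr1 => /(_ isT); apply: lt_le_trans.
  by rewrite divr_gt0// (lt_le_trans _ K1).
(* [K / (k L)] exceeds [1/k] because [L < K]: take [t] in between. *)
have [t /andP[kt tlt]] : exists t, k%:R^-1 < t < Num.min 1 (K / (k%:R * L)).
  exists ((k%:R^-1 + Num.min 1 (K / (k%:R * L))) / 2).
  have kK : k%:R^-1 < Num.min 1 (K / (k%:R * L)).
    rewrite lt_min k1 /= ltr_pdivlMr ?mulr_gt0//.
    by rewrite mulrA mulVf ?gt_eqF// mul1r.
  by rewrite !midf_lt.
move: tlt; rewrite lt_min => /andP[t1 tK].
have := le_all t; rewrite kt ltW// => /(_ isT); rewrite leNgt => /negP; apply.
by rewrite mulrC -ltr_pdivlMr// (lt_le_trans tK)// invfM mulrA.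
Qed.

End sharpness.

(** * The sharp rearrangement inequality *)

Unset Implicit Arguments.

Theorem theorem2 (R : realType) (d : measure_display) (X : measurableType d)
    (mu : probability X R) (k : nat) (T : set (set X))
    (hk : (2 <= k)%N) (hmu : non_atomic mu) (hT : homogeneous_tree mu k T) :
  (forall (w : X -> R) (c : R), A1_weight mu T w -> A1_constant mu T w c ->
     rearrangement_bound mu w (k%:R * c - k%:R + 1)) /\
  (forall c : R, 1 <= c ->
     forall K : R, K < k%:R * c - k%:R + 1 ->
       ~ (forall w : X -> R, A1_weight mu T w -> A1_constant mu T w c ->
            rearrangement_bound mu w K)).
Proof.
have [F hF] := homogeneous_tree_child_map hT.
split=> [w c [w0 iw _] [hc _]|c c1 L LK bnd].
  by case: hT => _ _ hD; exact: (A1_rearrangement_bound hk hF hD w0 iw hc).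
pose j : 'I_k := Ordinal (ltnW hk).
have [wA1 wc] := two_valued_weight_A1 j hk hF c1.
exact: (two_valued_weight_not_bound (j := j) hk hF c1 LK (bnd _ wA1 wc)).
Qed.
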